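(* Let $r>0$ and $V=\mathbb{R}$, and assume that $M(v)>0$ for all $v\in\mathbb{R}$. Let $g^0\in L^\infty(\mathbb{R}\times V)$ be such that $0\le g^0(x,v)\le M(v)$ for all $(x,v)\in\mathbb{R}\times V$, and such that there exist $x_L$ and $\gamma\in(0,1)$ with $g^0(x,v)\ge\gamma M(v)$ for all $x\le x_L$ and $v\in V$. Let $g$ be the solution of the Cauchy problem $$\partial_tg+v\partial_xg=\big(M(v)\rho_g-g\big)+r\rho_g\big(M(v)-g\big)\ \text{ on }\mathbb{R}_+\times\mathbb{R}\times V,\qquad g(0,x,v)=g^0(x,v).$$ Then for all $c>0$, $$(\forall v\in V)\quad\lim_{t\to+\infty}\Big(\sup_{x\le ct}|M(v)-g(t,x,v)|\Big)=0.$$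
   Context: $M\in L^1(\mathbb{R})\cap\mathcal{C}^0(\mathbb{R})$ satisfies $\int_{\mathbb{R}}M\,dv=1$, $\int_{\mathbb{R}}vM(v)\,dv=0$, $\int_{\mathbb{R}}v^2M(v)\,dv<+\infty$. $\rho_g(t,x)=\int_Vg(t,x,v)\,dv$. The solution $g$ is the unique solution in the sense of distributions with $0\le g\le M$, identified with its mild form: for all $(t,x,v)$, $g(t,x,v)=g^0(x-vt,v)e^{-\int_0^ta(s)ds}+\int_0^te^{-\int_s^ta(\tau)d\tau}(1+r)M(v)\rho_g(s,x-v(t-s))\,ds$, where $a(\tau)=1+r\rho_g(\tau,x-(t-\tau)v)$. *)

(* Defs.v *)
From HB Require Import structures.
From mathcomp Require Import all_boot all_order all_algebra.
From mathcomp Require Import all_classical all_reals all_analysis.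
Import Order.TTheory GRing.Theory Num.Theory.
Import numFieldNormedType.Exports.

Set Implicit Arguments.
Unset Strict Implicit.
Unset Printing Implicit Defensive.

Local Open Scope classical_set_scope.
Local Open Scope ring_scope.

(* The velocity set is V = R throughout. *)

Record velocity_profile (R : realType) (M : R -> R) : Prop := VelocityProfile {
  vp_continuous : continuous M ;
  vp_integrable : lebesgue_measure.-integrable [set: R] (EFin \o M) ;
  vp_mass : (\int[lebesgue_measure]_(v in [set: R]) (M v)%:E = 1)%E ;
  vp_mean : (\int[lebesgue_measure]_(v in [set: R]) (v * M v)%:E = 0)%E ;
  vp_variance :
    (\int[lebesgue_measure]_(v in [set: R]) (v ^+ 2 * M v)%:E < +oo)%E }.

Definition macro_density (R : realType) (g : R -> R -> R -> R) (t x : R) : R :=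
  (\int[lebesgue_measure]_(v in [set: R]) g t x v)%R.

(* Absorption rate at time tau along the characteristic that passes through
   (t, x) with velocity v. *)
Definition absorption (R : realType) (r : R) (g : R -> R -> R -> R)
    (t x v tau : R) : R :=
  1 + r * macro_density g tau (x - (t - tau) * v).

(* The mild (Duhamel) form, along the characteristics of the transport operator
   d_t + v d_x, of
     d_t g + v d_x g = (M rho_g - g) + r rho_g (M - g),   g(0, ., .) = g0.
   Values of g at negative times are irrelevant. The measurability clause makes
   every integral below that of a measurable function. *)
Record kinetic_solution (R : realType) (r : R) (M : R -> R) (g0 : R -> R -> R)
    (g : R -> R -> R -> R) : Prop := KineticSolution {
  ks_measurable :
    measurable_fun [set z : R * R * R | 0 <= z.1.1]
      (fun z : R * R * R => g z.1.1 z.1.2 z.2) ;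
  ks_bounds : forall t x v : R, 0 <= t -> 0 <= g t x v <= M v ;
  ks_mild : forall t x v : R, 0 <= t ->
    g t x v =
      g0 (x - v * t) v
        * expR (- (\int[lebesgue_measure]_(s in `[0%R, t])
                     absorption r g t x v s)%R)
      + (\int[lebesgue_measure]_(s in `[0%R, t])
           (expR (- (\int[lebesgue_measure]_(tau in `[s, t])
                       absorption r g t x v tau)%R)
            * ((1 + r) * M v * macro_density g s (x - v * (t - s)))))%R }.

(* Main.v *)
Require Import Defs.
From HB Require Import structures.
From mathcomp Require Import all_boot all_order all_algebra.
From mathcomp Require Import all_classical all_reals all_analysis.
From mathcomp Require Import measurable_realfun ring lra.
Import Order.TTheory GRing.Theory Num.Theory.
Import numFieldNormedType.Exports.

Set Implicit Arguments.
Unset Strict Implicit.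
Unset Printing Implicit Defensive.

Local Open Scope classical_set_scope.
Local Open Scope ring_scope.

(** The deviation from [M] is governed by the density [rho], and everything rests
    on one lower bound ([g_ge_response]): if a particle arriving at [(t, x)] with
    velocity [v] has seen a density at least [k] between the times [t - be] and
    [t - al], then [g t x v / M v] is at least
    [(1 + r) k / (1 + r k) * exp (- (1 + r) al) * (1 - exp (- (be - al)))].
    With [a = 1 + r rho] along the characteristic, the source term
    [(1 + r) rho] of Duhamel's formula dominates a multiple of [a], and [a] times
    the exponential weight has that weight as its primitive.  The bound is
    monotone in the density, so it replaces a comparison principle.

    Invasion at any speed ([front_invasion]).  In the frame moving with speed [c],
    the front [m exp (- lam z^+)], cut off at a distance [L], stays below the
    density when [lam] and [m] are small and [L] is large.  The response to a level
    [k <= 1 / 2] exceeds [k] by a fixed factor, already for particles of bounded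
    velocity and bounded time of flight ([slow_particles]), which pays for the
    variation of the front over the distance they travel.  Near the cut-off this
    fails, as slow particles may come from where the front vanishes.  There the fast
    ones take over ([fast_particles]): since [M > 0] everywhere there are particles
    with [lam (v - c) >= 2 + r]; over a flight of duration [T] they gain at least a
    factor [exp ((2 + r) T)] on the front, while the absorption costs at most a
    factor [exp (- (1 + r) T)], so that a long flight compensates for their rarity,
    whatever [c] is.  The particles considered made their last jump at least [tau0]
    earlier, so the comparison with the front is an induction over time steps of
    length [tau0].

    Convergence ([spreads_near1]).  If the density is eventually at least [m]
    on [x <= c t], then on [x <= c' t] with [c' < c] it is eventually at least any
    value below the response [(1 + r) m / (1 + r m)], because a bounded velocity
    during a bounded time does not bridge the gap [(c - c') t].  The response map
    moves every [m] in [(0, 1)] towards [1] geometrically; since every speed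
    is available at the start, iteration brings the density above every level below
    [1], and the response to such a density bounds [g] from below by a
    value close to [M]. *)

(** * Integrals over intervals *)

Section interval_integrals.
Context {R : realType}.
Local Notation mu := (@lebesgue_measure R).
Implicit Types (f g : R -> R) (x y z lo hi : R).

Lemma integrable_itvS f x y x' y' : x <= x' -> y' <= y ->
  mu.-integrable `[x, y] (EFin \o f) -> mu.-integrable `[x', y'] (EFin \o f).
Proof.
by move=> xx yy; apply: integrableS => //; apply: subset_itv; rewrite bnd_simp.
Qed.

Lemma bounded_integrable_itv f x y lo hi :
  measurable_fun `[x, y] f -> (forall s, x <= s <= y -> lo <= f s <= hi) ->
  mu.-integrable `[x, y] (EFin \o f).
Proof.
move=> mf bf; apply: measurable_bounded_integrable => //.
  by rewrite /= lebesgue_measure_itv/=; case: ifPn => // _; rewrite -EFinB ltry.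
exists (`|lo| + `|hi|); split; first exact: num_real.
move=> N ltN s; rewrite /= in_itv/= => xs; apply: le_trans (ltW ltN).
have /andP[l h] := bf s xs.
have := ler_norm hi; have := ler_norm (- lo).
have := normr_ge0 lo; have := normr_ge0 hi.
rewrite normrN => *; rewrite ler_norml; apply/andP; split; lra.
Qed.

Lemma Rintegral_cst_itv (k : R) x y : x <= y ->
  \int[mu]_(s in `[x, y]) k = k * (y - x).
Proof.
move=> xy; rewrite Rintegral_cst//= lebesgue_measure_itv/= lte_fin.
case: ltP => [//|yx]; have -> : x = y by apply/eqP; rewrite eq_le xy yx.
by rewrite subrr.
Qed.

Lemma cst_integrable_itv (k : R) x y : mu.-integrable `[x, y] (EFin \o cst k).
Proof. by apply: (@bounded_integrable_itv _ _ _ k k) => // s _; rewrite lexx. Qed.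

Lemma Rintegral_itv_bounds f x y lo hi : x <= y ->
  mu.-integrable `[x, y] (EFin \o f) -> (forall s, x <= s <= y -> lo <= f s <= hi) ->
  lo * (y - x) <= \int[mu]_(s in `[x, y]) f s <= hi * (y - x).
Proof.
move=> xy fi bf; rewrite -!(Rintegral_cst_itv _ xy); apply/andP; split.
  apply: le_Rintegral => //; [exact: cst_integrable_itv|].
  by move=> s; rewrite /= in_itv/= => /bf /andP[].
apply: le_Rintegral => //; [exact: cst_integrable_itv|].
by move=> s; rewrite /= in_itv/= => /bf /andP[].
Qed.

Lemma integrable_mulr f x y (k : R) : mu.-integrable `[x, y] (EFin \o f) ->
  mu.-integrable `[x, y] (EFin \o (fun s => f s * k)).
Proof. by move=> fi; apply: (eq_integrable _ _ _ _ (integrableZr _ k fi)). Qed.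

Lemma integrable_mull f x y (k : R) : mu.-integrable `[x, y] (EFin \o f) ->
  mu.-integrable `[x, y] (EFin \o (fun s => k * f s)).
Proof. by move=> fi; apply: (eq_integrable _ _ _ _ (integrableZl _ k fi)). Qed.

Lemma Rintegral_chasles f x y z : x <= y -> y <= z ->
  mu.-integrable `[x, z] (EFin \o f) ->
  \int[mu]_(s in `[x, z]) f s =
  \int[mu]_(s in `[x, y]) f s + \int[mu]_(s in `[y, z]) f s.
Proof.
move=> xy yz fi.
have := @Rintegral_itvB _ f (BLeft x) (BRight z) y fi.
rewrite !bnd_simp => /(_ xy yz) E.
apply/eqP; rewrite addrC -subr_eq E Rintegral_itv_obnd_cbnd//.
by apply: integrableS fi => //; apply: subset_itv; rewrite bnd_simp.
Qed.

(** A function whose increments are quadratically small is constant: cut the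
    interval into [n] equal pieces and let [n] tend to infinity. *)
Lemma quadratic_increments_cst f x y K : 0 <= K -> x <= y ->
  (forall s s', x <= s -> s <= s' -> s' <= y ->
     `|f s' - f s| <= K * (s' - s) ^+ 2) ->
  f y = f x.
Proof.
move=> K0 xy incr; apply/eqP; rewrite -subr_eq0 -normr_eq0 eq_le normr_ge0 andbT.
pose h n : R := (y - x) / n.+1%:R.
have n0 n : 0 < n.+1%:R :> R by [].
have h0 n : 0 <= h n by rewrite divr_ge0// subr_ge0.
have partial n k : (k <= n.+1)%N ->
    `|f (x + k%:R * h n) - f x| <= k%:R * (K * h n ^+ 2).
  elim: k => [_|k IH kn]; first by rewrite !mul0r addr0 subrr normr0.
  have -> : f (x + k.+1%:R * h n) - f x =
    (f (x + k.+1%:R * h n) - f (x + k%:R * h n)) + (f (x + k%:R * h n) - f x).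
    by rewrite addrA subrK.
  apply: (le_trans (ler_normD _ _)).
  have -> : k.+1%:R * (K * h n ^+ 2) = K * h n ^+ 2 + k%:R * (K * h n ^+ 2).
    by rewrite -natr1; ring.
  apply: lerD; last exact/IH/ltnW.
  have E : x + k.+1%:R * h n - (x + k%:R * h n) = h n by rewrite -natr1; ring.
  rewrite -[X in K * X ^+ 2]E; apply: incr.
  - by rewrite lerDl mulr_ge0.
  - by rewrite -subr_ge0 E.
  - rewrite -lerBrDl (_ : y - x = n.+1%:R * h n); last first.
      by rewrite /h mulrCA divff ?mulr1// gt_eqF.
    by rewrite ler_wpM2r// ler_nat.
have le n : `|f y - f x| <= K * (y - x) ^+ 2 * n.+1%:R^-1.
  have := partial n n.+1 (leqnn _).
  have -> : n.+1%:R * h n = y - x by rewrite /h mulrCA divff ?mulr1// gt_eqF.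
  have -> : n.+1%:R * (K * h n ^+ 2) = K * (y - x) ^+ 2 * n.+1%:R^-1.
    by rewrite /h; field; rewrite gt_eqF.
  by rewrite (_ : x + (y - x) = y)//; ring.
apply/ler_addgt0Pl => e e0; rewrite addr0.
have [P0|P0] := eqVneq (K * (y - x) ^+ 2) 0.
  by apply: (le_trans (le 0%N)); rewrite P0 mul0r ltW.
have P1 : 0 < K * (y - x) ^+ 2 by rewrite lt_def P0 mulr_ge0// sqr_ge0.
pose n := Num.truncn (K * (y - x) ^+ 2 / e).
have hn : K * (y - x) ^+ 2 / e < n.+1%:R.
  by apply: truncnS_gt.
apply: (le_trans (le n)).
by rewrite ler_pdivrMr// [e * _]mulrC -ler_pdivrMr// ltW.
Qed.

End interval_integrals.

(** * The exponential weight of Duhamel's formula *)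

(** With [d] the integral of the rate over a short interval and [w], [w'] the
    weights at its ends, this bounds the error made when the integral of the rate
    times the weight is replaced by the increment of the weight. *)
Lemma expR_second_order {R : realType} (d w w' J : R) : 0 <= d -> 0 < w' -> w' <= 1 ->
  w = w' * expR (- d) -> d * w <= J <= d * w' -> `|J - (w' - w)| <= d ^+ 2.
Proof.
move=> d0 w'0 w'1 ww' /andP[Jl Ju].
have ed : 1 - d <= expR (- d) by exact: expR_ge1Dx.
have ed' : 1 + d <= expR d by exact: expR_ge1Dx.
have e1 : expR (- d) * expR d = 1 by rewrite -expRD addNr expR0.
have Wu : w' - w <= d * w' by nra.
have w0 : 0 < w by rewrite ww' mulr_gt0// expR_gt0.
have Wl : d * w <= w' - w.
  have -> : w' = w * expR d by rewrite ww' -mulrA e1 mulr1.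
  nra.
have key : d * w' - d * w <= d ^+ 2 by nra.
rewrite ler_norml; apply/andP; split; lra.
Qed.

(** The weight [W s = exp (- \int_s^t a)] enters only through its flow property
    [W_split] and its final value; it is kept abstract. *)
Section integrating_factor.
Context {R : realType}.
Local Notation mu := (@lebesgue_measure R).
Variables (a W : R -> R) (t C : R).
Implicit Types (h : R -> R) (s u x y lo hi : R).
Hypothesis ma : measurable_fun `[0, t] a.
Hypothesis a_bounds : forall s, 0 <= s <= t -> 1 <= a s <= C.
Hypothesis W_split : forall x y, 0 <= x -> x <= y -> y <= t ->
  W x = W y * expR (- \int[mu]_(u in `[x, y]) a u).
Hypothesis W_end : W t = 1.

Let ai x y : 0 <= x -> y <= t -> mu.-integrable `[x, y] (EFin \o a).
Proof.
move=> x0 yt; apply: (@integrable_itvS _ _ 0 t) => //.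
exact: (@bounded_integrable_itv _ _ _ _ 1 C).
Qed.

Let a_bounds_sub x y s : 0 <= x -> y <= t -> x <= s <= y -> 1 <= a s <= C.
Proof. by move=> x0 yt /andP[xs sy]; apply: a_bounds; apply/andP; split; lra. Qed.

Let int_a_bounds x y : 0 <= x -> x <= y -> y <= t ->
  1 * (y - x) <= \int[mu]_(u in `[x, y]) a u <= C * (y - x).
Proof.
move=> x0 xy yt; apply: Rintegral_itv_bounds => //; first exact: ai.
by move=> s; exact: a_bounds_sub.
Qed.

Lemma integrating_factor_gt0 s : 0 <= s -> s <= t -> 0 < W s.
Proof. by move=> s0 st; rewrite (W_split s0 st)// W_end mul1r expR_gt0. Qed.

Lemma integrating_factor_decay x y : 0 <= x -> x <= y -> y <= t ->
  W x <= W y * expR (- (y - x)).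
Proof.
move=> x0 xy yt; rewrite (W_split x0 xy yt) ler_pM2l; last by apply: integrating_factor_gt0; lra.
rewrite ler_expR lerN2.
by have /andP[+ _] := int_a_bounds x0 xy yt; rewrite mul1r.
Qed.

Lemma integrating_factor_le x y : 0 <= x -> x <= y -> y <= t -> W x <= W y.
Proof.
move=> x0 xy yt; apply: (le_trans (integrating_factor_decay x0 xy yt)).
rewrite ler_piMr//; first by apply: ltW; apply: integrating_factor_gt0; lra.
by rewrite -expR0 ler_expR; lra.
Qed.

Lemma integrating_factor_ge s : 0 <= s -> s <= t -> expR (- (C * (t - s))) <= W s.
Proof.
move=> s0 st; rewrite (W_split s0 st)// W_end mul1r ler_expR lerN2.
by have /andP[] := int_a_bounds s0 st (lexx t).
Qed.

Lemma integrating_factor_le1 s : 0 <= s -> s <= t -> W s <= 1.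
Proof. by move=> s0 st; rewrite -W_end; exact: integrating_factor_le. Qed.

Lemma measurable_integrating_factor : measurable_fun `[0, t] W.
Proof.
(* [W] is monotone on [0, t]; clamping makes it monotone on the whole line. *)
have [t0|t0] := leP 0 t; last first.
  by rewrite set_itv_ge ?bnd_simp ?leNgt ?t0//; exact: measurable_fun_set0.
pose clamped x := W (Num.min (Num.max 0 x) t).
have mono : {homo clamped : x y / x <= y}.
  move=> x y xy; apply: integrating_factor_le.
  - by rewrite le_min le_max lexx.
  - by rewrite le_min2// ge_max !le_max xy lexx orbT.
  - by rewrite ge_min lexx orbT.
have mW' : measurable_fun `[0, t] clamped by exact: nondecreasing_measurable.
apply: eq_measurable_fun mW' => s.
rewrite inE/= in_itv/= => /andP[s0 st].
by rewrite /clamped (max_idPr s0) (min_idPl st).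
Qed.

Let mW x y : 0 <= x -> y <= t -> measurable_fun `[x, y] W.
Proof.
move=> x0 yt; apply: measurable_funS measurable_integrating_factor => //.
by apply: subset_itv; rewrite bnd_simp.
Qed.

Lemma integrable_mul_integrating_factor h x y lo hi : 0 <= x -> y <= t ->
  0 <= lo -> measurable_fun `[x, y] h -> (forall s, x <= s <= y -> lo <= h s <= hi) ->
  mu.-integrable `[x, y] (EFin \o (fun s => h s * W s)).
Proof.
move=> x0 yt lo0 mh bh; apply: (@bounded_integrable_itv _ _ _ _ 0 hi).
  by apply: measurable_funM => //; exact: mW.
move=> s xsy; have /andP[l u] := bh s xsy; move/andP: xsy => [xs sy].
have s0 : 0 <= s by lra.
have st : s <= t by lra.
have W1 := integrating_factor_le1 s0 st; have W0 := integrating_factor_gt0 s0 st.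
apply/andP; split; first by apply: mulr_ge0; lra.
rewrite -[leRHS]mulr1; apply: ler_pM => //; lra.
Qed.

(** [W' = a W], in integral form.  Since [a] is only measurable, [W] need not be
    differentiable everywhere; but on a short interval both sides equal
    [(\int a) W] up to an error of second order in the length. *)
Lemma integral_integrating_factor x y : 0 <= x -> x <= y -> y <= t ->
  \int[mu]_(s in `[x, y]) (a s * W s) = W y - W x.
Proof.
move=> x0 xy yt.
have aWi u v : x <= u -> v <= y ->
    mu.-integrable `[u, v] (EFin \o (fun s => a s * W s)).
  move=> xu vy; apply: (@integrable_mul_integrating_factor _ _ _ 1 C) => //.
  - lra.
  - lra.
  - apply: measurable_funS ma => //.
    by apply: subset_itv; rewrite bnd_simp; lra.
  - by move=> s /andP[us sv]; apply: a_bounds; apply/andP; split; lra.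
pose D s := \int[mu]_(u in `[x, s]) (a u * W u) - W s.
suff : D y = D x.
  rewrite /D set_itv1 Rintegral_set1; set I := \int[mu]_(u in _) _.
  by move: I (W x) (W y) => I w w' ?; lra.
apply: (@quadratic_increments_cst _ _ _ _ (C ^+ 2)) => //; first exact: sqr_ge0.
move=> s s' xs ss' s'y.
have s0 : 0 <= s by lra.
have s'0 : 0 <= s' by lra.
have s't : s' <= t by lra.
pose d := \int[mu]_(u in `[s, s']) a u.
have aii := ai s0 s't.
have awi z : mu.-integrable `[s, s'] (EFin \o (fun u => a u * z)).
  exact: integrable_mulr.
have bounds u : s <= u <= s' -> [/\ 0 <= a u, W s <= W u & W u <= W s'].
  move=> /andP[su us'].
  have /andP[au _] := a_bounds_sub s0 s't (introT andP (conj su us')).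
  have u0 := le_trans s0 su; have ut := le_trans us' s't.
  by split; [exact: le_trans au|exact: integrating_factor_le|
    exact: integrating_factor_le].
have /andP[d1 dC] : 1 * (s' - s) <= d <= C * (s' - s) by exact: int_a_bounds.
have dd : d ^+ 2 <= C ^+ 2 * (s' - s) ^+ 2.
  have d0 : 0 <= d by apply: le_trans d1; rewrite mul1r subr_ge0.
  by rewrite -exprMn lerXn2r ?nnegrE ?(le_trans d0 dC).
apply: le_trans dd; rewrite /D (@Rintegral_chasles _ _ x s s')//; last exact: aWi.
have alg (i j w w' : R) : i + j - w' - (i - w) = j - (w' - w) by ring.
rewrite alg; apply: expR_second_order (W_split s0 ss' s't) _.
- by apply: le_trans d1; rewrite mul1r subr_ge0.
- exact: integrating_factor_gt0.
- exact: integrating_factor_le1.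
have dz z : d * z = \int[mu]_(u in `[s, s']) (a u * z).
  by rewrite RintegralZr.
have aWi' := aWi s s' xs s'y.
rewrite !dz; apply/andP; split; apply: le_Rintegral => //.
- move=> u; rewrite /= in_itv/= => /bounds[? ? ?]; exact: ler_wpM2l.
- move=> u; rewrite /= in_itv/= => /bounds[? ? ?]; exact: ler_wpM2l.
Qed.

End integrating_factor.

(** * The response to a density bounded below *)

Section saturated_growth.
Context {R : realType}.
Local Notation mu := (@lebesgue_measure R).

(** The value [g / M] that is in equilibrium with a density kept equal to [k]:
    the solution [theta] of [(1 + r) k = (1 + r k) theta]. *)
Definition response (r k : R) := (1 + r) * k / (1 + r * k).

Lemma response_le r k q : 0 <= r -> 0 <= k -> k <= q ->
  response r k * (1 + r * q) <= (1 + r) * q.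
Proof.
move=> r0 k0 kq; rewrite /response mulrAC ler_pdivrMr; last nra.
have := mulr_ge0 r0 k0; nra.
Qed.

Lemma response_ge0 r k : 0 <= r -> 0 <= k -> 0 <= response r k.
Proof. by move=> r0 k0; rewrite /response divr_ge0//; nra. Qed.

(** If the density [q] seen along a characteristic is at least [k] between the
    times [x] and [y], the source term of Duhamel's formula is at least the
    equilibrium response to [k], up to the time [y - x] needed to relax to this
    equilibrium and up to the losses after [y].  Writing [a = 1 + r q], the
    reason is that [(1 + r) q] dominates [response r k * a], and [a W] has the
    explicit primitive [W]. *)
Lemma duhamel_source_ge (r k m t x y : R) (q : R -> R) :
  0 <= r -> 0 <= k -> 0 <= m -> 0 <= x -> x <= y -> y <= t ->
  measurable_fun `[0, t] q -> (forall s, 0 <= s <= t -> 0 <= q s <= 1) ->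
  (forall s, x <= s <= y -> k <= q s) ->
  m * (response r k * (expR (- ((1 + r) * (t - y))) * (1 - expR (- (y - x))))) <=
  \int[mu]_(s in `[0, t])
    (expR (- \int[mu]_(u in `[s, t]) (1 + r * q u)) * ((1 + r) * m * q s)).
Proof.
move=> r0 k0 m0 x0 xy yt mq q01 kq.
pose a u := 1 + r * q u.
have ma : measurable_fun `[0, t] a.
  by apply: measurable_funD => //; exact: measurable_funM.
have ab s : 0 <= s <= t -> 1 <= a s <= 1 + r.
  by move=> /q01/andP[q0 q1]; rewrite /a; apply/andP; split; nra.
have ai u v : 0 <= u -> v <= t -> mu.-integrable `[u, v] (EFin \o a).
  move=> u0 vt; apply: (@integrable_itvS _ _ 0 t) => //.
  exact: (@bounded_integrable_itv _ _ _ _ 1 (1 + r)).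
have [W [WE W_split W_end]] : exists W : R -> R,
    [/\ forall s, W s = expR (- \int[mu]_(u in `[s, t]) a u),
       forall u v, 0 <= u -> u <= v -> v <= t ->
         W u = W v * expR (- \int[mu]_(s in `[u, v]) a s) & W t = 1].
  exists (fun s => expR (- \int[mu]_(u in `[s, t]) a u)); split => //.
  - move=> u v u0 uv vt; rewrite (@Rintegral_chasles _ _ u v t)//; last exact: ai.
    by rewrite -expRD opprD addrC.
  - by rewrite set_itv1 Rintegral_set1 oppr0 expR0.
have phi_le s : x <= s <= y -> response r k * a s <= (1 + r) * q s.
  by move=> /kq; exact: response_le.
have phi0 := response_ge0 r0 k0.
move: (response r k) phi0 phi_le => phi phi0 phi_le.
have src_ge0 s : 0 <= s <= t -> 0 <= (1 + r) * m * q s.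
  by move=> /q01/andP[q0 q1]; rewrite !mulr_ge0//; lra.
have msrc : measurable_fun `[0, t] (fun s => (1 + r) * m * q s).
  exact: measurable_funM.
have srci u v : 0 <= u -> v <= t -> mu.-integrable `[u, v]
    (EFin \o (fun s => (1 + r) * m * q s * W s)).
  move=> u0 vt; apply: (@integrable_itvS _ _ 0 t) => //.
  apply: (integrable_mul_integrating_factor ma ab W_split W_end _ _ (lexx 0) (hi := (1 + r) * m)) => //.
  move=> s st; rewrite src_ge0//=; have /andP[q0 q1] := q01 s st.
  by rewrite ler_piMr// mulr_ge0//; lra.
under eq_Rintegral => s _ do rewrite -WE mulrC.
have part_ge0 u v : 0 <= u -> v <= t ->
    0 <= \int[mu]_(s in `[u, v]) ((1 + r) * m * q s * W s).
  move=> u0 vt; apply: Rintegral_ge0 => s; rewrite /= in_itv/= => /andP[us sv].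
  rewrite mulr_ge0 ?WE ?expR_ge0// src_ge0//.
  by rewrite (le_trans u0 us) (le_trans sv vt).
rewrite (@Rintegral_chasles _ _ 0 x t)//; [|lra|exact: srci].
rewrite (@Rintegral_chasles _ _ x y t)//; last exact: srci.
have I1 := part_ge0 0 x (lexx 0) (le_trans xy yt).
have I3 := part_ge0 y t (le_trans x0 xy) (lexx t).
apply: (@le_trans _ _ (\int[mu]_(s in `[x, y]) ((1 + r) * m * q s * W s))); last first.
  by rewrite addrCA lerDl addr_ge0.
have y0 : 0 <= y by exact: le_trans xy.
have Wyge : expR (- ((1 + r) * (t - y))) <= W y.
  exact: (integrating_factor_ge ma ab).
have Wxy : W x <= W y * expR (- (y - x)).
  exact: (integrating_factor_decay ma ab).
have E : \int[mu]_(s in `[x, y]) (a s * W s) = W y - W x.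
  exact: (integral_integrating_factor ma ab).
have e1 : expR (- (y - x)) <= 1 by rewrite -expR0 ler_expR oppr_le0 subr_ge0.
apply: (@le_trans _ _ (m * phi * (W y - W x))).
  rewrite -mulrA ler_wpM2l// ler_wpM2l//.
  apply: (@le_trans _ _ (W y * (1 - expR (- (y - x))))).
    by apply: ler_wpM2r; rewrite ?subr_ge0.
  by rewrite mulrBr mulr1 lerD2l lerN2.
have aWi : mu.-integrable `[x, y] (EFin \o (fun s => a s * W s)).
  apply: (integrable_mul_integrating_factor ma ab W_split W_end _ _ (lo := 1) (hi := 1 + r)) => //.
    by apply: measurable_funS ma => //; apply: subset_itv; rewrite bnd_simp.
  move=> s /andP[xs sy]; apply: ab.
  by rewrite (le_trans x0 xs) (le_trans sy yt).
rewrite -E -RintegralZl//; apply: le_Rintegral => //.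
- exact: integrable_mull.
- exact: srci.
move=> s; rewrite /= in_itv/= => xsy.
rewrite mulrA ler_wpM2r ?WE ?expR_ge0// [(1 + r) * m]mulrC -!mulrA ler_wpM2l//.
exact: phi_le.
Qed.

End saturated_growth.

(** * Mass of velocity intervals *)

Section velocity_mass.
Context {R : realType}.
Local Notation mu := (@lebesgue_measure R).
Variable M : R -> R.
Implicit Types (u v w k : R).
Hypothesis M_profile : velocity_profile M.
Hypothesis M_gt0 : forall v, 0 < M v.

Definition velocity_mass u w := \int[mu]_(v in `[u, w]) M v.

Lemma M_integrable (A : set R) : measurable A -> mu.-integrable A (EFin \o M).
Proof.
move=> mA; apply: (@integrableS _ _ _ _ setT) => //; exact: vp_integrable.
Qed.

Lemma velocity_mass_gt0 u w : u < w -> 0 < velocity_mass u w.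
Proof.
move=> uw.
have cM : {within `[u, w], continuous M}.
  by apply: continuous_subspaceT; exact: vp_continuous.
have [z _ zmin] := EVT_min (ltW uw) cM.
have Mi : mu.-integrable `[u, w] (EFin \o M) by exact: M_integrable.
have : 0 < M z * (w - u) by rewrite mulr_gt0 ?subr_gt0.
move=> /lt_le_trans; apply; rewrite -Rintegral_cst_itv; last exact: ltW.
by apply: le_Rintegral => //; exact: cst_integrable_itv.
Qed.

Lemma velocity_mass_total (e : R) : 0 < e ->
  exists2 V : R, 0 < V & 1 - e <= velocity_mass (- V) V.
Proof.
move=> e0.
have lim : (\int[mu]_(v in [set` `[- n%:R, n%:R]%R]) (M v)%:E)%E @[n --> \oo] -->
    (1%:E : \bar R).
  rewrite -[1%:E](vp_mass M_profile) -(bigcup_itvT true false).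
  apply: ge0_nondecreasing_set_cvg_integral => //.
  - move=> m n mn; apply/subsetPset/subset_itv; rewrite bnd_simp ?lerN2 ler_nat//.
  - move=> n; apply/measurable_EFinP; apply: measurable_funTS.
    by apply: continuous_measurable_fun; exact: vp_continuous.
  - by move=> n v _; rewrite lee_fin ltW.
have /fine_cvgP[_ /cvgrPdist_lt/(_ e e0)[n _ H]] := lim.
exists n.+1%:R => //.
have /= := H n.+1 (leqnSn n); rewrite ltr_norml => /andP[_ h].
by rewrite lerBlDr addrC -lerBlDr; exact: ltW h.
Qed.

End velocity_mass.

(** * Lower bounds for the solution *)

Section kinetic.
Context {R : realType}.
Local Notation mu := (@lebesgue_measure R).
Variables (r : R) (M : R -> R) (g0 : R -> R -> R) (g : R -> R -> R -> R).
Implicit Types (t x v u w k al be s : R).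
Hypothesis r_gt0 : 0 < r.
Hypothesis M_profile : velocity_profile M.
Hypothesis g0_bounds : forall x v, 0 <= g0 x v <= M v.
Hypothesis g_sol : kinetic_solution r M g0 g.
Local Notation rho := (macro_density g).

(* Extending [g] by zero to negative times makes it measurable on a full product
   space, where Tonelli's theorem applies to the density. *)
Let G : R * R * R -> \bar R :=
  (fun z => (g z.1.1 z.1.2 z.2)%:E) \_ [set z | 0 <= z.1.1].

Let mD : measurable [set z : R * R * R | 0 <= z.1.1].
Proof.
rewrite (_ : [set _ | _] = setT `&` (fst \o fst) @^-1` `[0, +oo[%classic); last first.
  by apply/seteqP; split => z /=; rewrite in_itv/= andbT => // -[].
have mf : measurable_fun setT (fst \o fst : R * R * R -> R).
  exact: measurableT_comp.
exact: mf.
Qed.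

Let mG : measurable_fun setT G.
Proof.
apply/(measurable_restrictT _ mD); apply/measurable_EFinP.
exact: ks_measurable g_sol.
Qed.

Let GE t x v : 0 <= t -> G (t, x, v) = (g t x v)%:E.
Proof. by move=> t0; rewrite /G patchE mem_set. Qed.

Let G_ge0 z : (0 <= G z)%E.
Proof.
rewrite /G patchE; case: ifPn => // /set_mem /= t0.
by rewrite lee_fin; have /andP[] := ks_bounds g_sol z.1.2 z.2 t0.
Qed.

Lemma g_ge0 t x v : 0 <= t -> 0 <= g t x v.
Proof. by move=> t0; have /andP[] := ks_bounds g_sol x v t0. Qed.

Lemma g_leM t x v : 0 <= t -> g t x v <= M v.
Proof. by move=> t0; have /andP[] := ks_bounds g_sol x v t0. Qed.

Lemma measurable_velocity t x : 0 <= t -> measurable_fun setT (EFin \o g t x).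
Proof.
move=> t0; have := measurable_fun_pair2 (t, x) mG.
by apply: eq_measurable_fun => v _; rewrite GE.
Qed.

Lemma integrable_velocity t x (A : set R) : 0 <= t -> measurable A ->
  mu.-integrable A (EFin \o g t x).
Proof.
move=> t0 mA; apply: (@integrableS _ _ _ mu setT) => //.
apply: le_integrable (M_integrable M_profile measurableT) => //.
  exact: measurable_velocity.
move=> v _ /=; rewrite lee_fin !ger0_norm ?g_ge0 ?g_leM//.
by apply: le_trans (g_leM x v t0); exact: g_ge0.
Qed.

Lemma macro_density_ge0 t x : 0 <= t -> 0 <= rho t x.
Proof. by move=> t0; apply: Rintegral_ge0 => v _; exact: g_ge0. Qed.

Lemma macro_density_le1 t x : 0 <= t -> rho t x <= 1.
Proof.
move=> t0; rewrite (_ : 1 = \int[mu]_(v in setT) M v).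
  apply: le_Rintegral => //; [exact: integrable_velocity|exact: M_integrable|].
  by move=> v _; exact: g_leM.
by rewrite /Rintegral (vp_mass M_profile).
Qed.

Lemma macro_density_ge_mass t x k u w : 0 <= t -> 0 <= k -> u <= w ->
  (forall v, u <= v <= w -> k * M v <= g t x v) ->
  k * velocity_mass M u w <= rho t x.
Proof.
move=> t0 k0 uw kg.
have gi := @integrable_velocity t x; have Mi := M_integrable M_profile.
rewrite /velocity_mass -RintegralZl//; last exact: Mi.
apply: (@le_trans _ _ (\int[mu]_(v in `[u, w]) g t x v)).
  by apply: le_Rintegral => //; [exact/integrable_mull/Mi|exact: gi].
rewrite /macro_density /Rintegral fine_le//.
- by apply: integrable_fin_num => //; exact: gi.
- by apply: integrable_fin_num => //; exact: gi.
- apply: ge0_subset_integral => //; first exact: measurable_velocity.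
  by move=> v _; rewrite lee_fin; exact: g_ge0.
Qed.

Lemma measurable_macro_density_char t x v :
  measurable_fun `[0, t] (fun s => rho s (x - v * (t - s))).
Proof.
have mF := @measurable_fun_fubini_tonelli_F _ _ (R * R)%type (measurableTypeR R) R mu G mG G_ge0.
have mchar : measurable_fun setT (fun s : R => (s, x - v * (t - s))).
  apply: measurable_fun_pair => //.
  apply: measurable_funB => //; apply: measurable_funM => //.
  exact: measurable_funB.
have mFc := measurableT_comp mF mchar.
have : measurable_fun `[0, t] (fun s => fine (fubini_F mu G (s, x - v * (t - s)))).
  by apply: measurable_funTS; apply: measurableT_comp => //.
apply: eq_measurable_fun => s; rewrite inE/= in_itv/= => /andP[s0 st].
rewrite /fubini_F /macro_density /Rintegral; congr fine.
by apply: eq_integral => w _; rewrite GE.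
Qed.

Let q_bounds t x v s : 0 <= s <= t -> 0 <= rho s (x - v * (t - s)) <= 1.
Proof.
by move=> /andP[s0 _]; rewrite macro_density_ge0//= macro_density_le1.
Qed.

Let mildE t x v : 0 <= t -> g t x v =
  g0 (x - v * t) v * expR (- \int[mu]_(s in `[0, t])
    (1 + r * rho s (x - v * (t - s)))) +
  \int[mu]_(s in `[0, t])
    (expR (- \int[mu]_(u in `[s, t]) (1 + r * rho u (x - v * (t - u)))) *
     ((1 + r) * M v * rho s (x - v * (t - s)))).
Proof.
move=> t0; have absE : absorption r g t x v =
    (fun s => 1 + r * rho s (x - v * (t - s))).
  by apply/funext => s; rewrite /absorption [v * _]mulrC.
by have := ks_mild g_sol x v t0; rewrite absE.
Qed.

Lemma g_ge_response t x v k al be :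
  0 <= k -> 0 <= al -> al <= be -> be <= t ->
  (forall tau : R, al <= tau <= be -> k <= rho (t - tau) (x - v * tau)) ->
  response r k * (expR (- ((1 + r) * al)) * (1 - expR (- (be - al)))) * M v
    <= g t x v.
Proof.
move=> k0 al0 albe bet kr; have t0 : 0 <= t by lra.
have Mv : 0 <= M v by apply: le_trans (g_leM x v t0); exact: g_ge0.
rewrite mildE//.
have src := @duhamel_source_ge R r k (M v) t (t - be) (t - al)
  (fun s => rho s (x - v * (t - s))) (ltW r_gt0) k0 Mv.
rewrite (_ : t - (t - al) = al) in src; last by ring.
rewrite (_ : t - al - (t - be) = be - al) in src; last by ring.
rewrite mulrC; apply: le_trans (src _ _ _ _ _ _) _.
- lra.
- lra.
- lra.
- exact: measurable_macro_density_char.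
- exact: q_bounds.
- move=> s /andP[sl su]; have := kr (t - s); rewrite subKr; apply.
  by apply/andP; split; lra.
rewrite lerDr mulr_ge0 ?expR_ge0//.
by have /andP[] := g0_bounds (x - v * t) v.
Qed.

Lemma g_ge_initial t x v : 0 <= t ->
  g0 (x - v * t) v * expR (- ((1 + r) * t)) <= g t x v.
Proof.
move=> t0; rewrite mildE//.
have /andP[g00 _] := g0_bounds (x - v * t) v.
have Mv : 0 <= M v by apply: le_trans (g_leM x v t0); exact: g_ge0.
apply: ler_wpDr.
  apply: Rintegral_ge0 => s; rewrite /= in_itv/= => st.
  have /andP[q0 _] := q_bounds x v st.
  by rewrite mulr_ge0 ?expR_ge0// !mulr_ge0//; have := r_gt0; lra.
apply: ler_wpM2l => //; rewrite ler_expR lerN2.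
have ab s : 0 <= s <= t -> 1 <= 1 + r * rho s (x - v * (t - s)) <= 1 + r.
  move=> /(q_bounds x v)/andP[q0 q1].
  rewrite lerDl lerD2l ler_piMr ?(ltW r_gt0)// andbT.
  by rewrite mulr_ge0// ltW.
have qi : mu.-integrable `[0, t]
    (EFin \o (fun s => 1 + r * rho s (x - v * (t - s)))).
  apply: (bounded_integrable_itv _ ab).
  apply: measurable_funD => //; apply: measurable_funM => //.
  exact: measurable_macro_density_char.
have /andP[_] := Rintegral_itv_bounds t0 qi ab.
by rewrite subr0.
Qed.

End kinetic.

(** * Invasion at every speed *)

(** The hypotheses of this section are all that the argument needs to know about
    [M] and about the solution; [rho] stands for its density and [mass u w] for the
    mass of [M] on the velocities between [u] and [w]. *)
Section propagation.
Context {R : realType}.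
Variables (r : R) (M : R -> R) (mass : R -> R -> R) (rho : R -> R -> R)
  (g0 : R -> R -> R) (g : R -> R -> R -> R) (xL gamma : R).
Implicit Types (t x v u w c k m al be : R).
Hypothesis r_gt0 : 0 < r.
Hypothesis M_gt0 : forall v, 0 < M v.
Hypothesis mass_gt0 : forall u w, u < w -> 0 < mass u w.
Hypothesis mass_total : forall e : R, 0 < e ->
  exists2 V : R, 0 < V & 1 - e <= mass (- V) V.
Hypothesis rho_ge_mass : forall t x k u w, 0 <= t -> 0 <= k -> u <= w ->
  (forall v, u <= v <= w -> k * M v <= g t x v) -> k * mass u w <= rho t x.
Hypothesis g_ge_response : forall t x v k al be,
  0 <= k -> 0 <= al -> al <= be -> be <= t ->
  (forall tau, al <= tau <= be -> k <= rho (t - tau) (x - v * tau)) ->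
  response r k * (expR (- ((1 + r) * al)) * (1 - expR (- (be - al)))) * M v
    <= g t x v.
Hypothesis g_ge_initial : forall t x v, 0 <= t ->
  g0 (x - v * t) v * expR (- ((1 + r) * t)) <= g t x v.
Hypothesis gamma_gt0 : 0 < gamma.
Hypothesis g0_left : forall x v, x <= xL -> gamma * M v <= g0 x v.

Lemma expR_small e : 0 < e -> exists2 S : R, 0 < S & expR (- S) <= e.
Proof.
move=> e0; exists e^-1; first by rewrite invr_gt0.
rewrite expRN -[leRHS]invrK lef_pV2 ?posrE ?expR_gt0 ?invr_gt0//.
by apply: le_trans (expR_ge1Dx _); rewrite lerDr.
Qed.

Lemma rho_ge_response t x u w k al be :
  0 <= k -> 0 <= al -> al <= be -> be <= t -> u <= w ->
  (forall v tau : R, u <= v <= w -> al <= tau <= be ->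
     k <= rho (t - tau) (x - v * tau)) ->
  response r k * (expR (- ((1 + r) * al)) * (1 - expR (- (be - al))))
    * mass u w <= rho t x.
Proof.
move=> k0 al0 albe bet uw krho; apply: rho_ge_mass => //.
- lra.
- apply: mulr_ge0; first by apply: response_ge0 => //; exact: ltW.
  apply: mulr_ge0; first exact: expR_ge0.
  by rewrite subr_ge0 -expR0 ler_expR; lra.
- by move=> v uvw; apply: g_ge_response => // tau; exact: krho.
Qed.

Lemma response_ge_id k : 0 <= k -> k <= 1 -> k <= response r k.
Proof.
move=> k0 k1; have rk0 : 0 <= r * k by rewrite mulr_ge0// ltW.
rewrite /response ler_pdivlMr; last lra.
rewrite mulrC mulrDl mulrDl !mul1r lerD2l mulrAC.
by apply: ler_piMr => //; rewrite mulr_ge0// ltW.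
Qed.

Lemma response_ge_linear k : 0 <= k -> k <= 2^-1 ->
  (1 + r) / (1 + r / 2) * k <= response r k.
Proof.
move=> k0 k1; have rk0 : 0 <= r * k by rewrite mulr_ge0// ltW.
have rk : r * k <= r * 2^-1 by rewrite ler_pM2l.
rewrite /response mulrAC; apply: ler_wpM2l; first by apply: mulr_ge0; lra.
by rewrite lef_pV2 ?posrE; lra.
Qed.

(** For [k <= 1 / 2] the response to [k] is at least [(1 + r) / (1 + r / 2) * k];
    restricting to bounded velocities and bounded times of flight gives away only a
    part of this factor, and the rest is still larger than one. *)
Lemma slow_particles : exists kap tau0 S V : R, [/\ 1 < kap, 0 < tau0, tau0 <= S,
  0 < V & forall t x k, 0 <= k -> k <= 2^-1 -> S <= t ->
    (forall v tau : R, - V <= v <= V -> tau0 <= tau <= S ->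
       k <= rho (t - tau) (x - v * tau)) -> kap * k <= rho t x].
Proof.
have r0 := r_gt0; have growth := response_ge_linear.
remember ((1 + r) / (1 + r / 2)) as kap0 eqn:kap0D.
have kap01 : 1 < kap0 by rewrite kap0D ltr_pdivlMr; lra.
remember ((kap0 - 1) / (4 * kap0)) as d eqn:dD.
have d0 : 0 < d by rewrite dD divr_gt0//; lra.
have dE : kap0 * d * 4 = kap0 - 1 by rewrite dD; field; lra.
have d1 : d <= 4^-1 by rewrite dD ler_pdivrMr; lra.
have tau00 : 0 < d / (1 + r) by rewrite divr_gt0//; lra.
have tau0E : (1 + r) * (d / (1 + r)) = d by field; lra.
have [S S0 eS] := expR_small d0.
have [V V0 mV] := mass_total d0.
(* The three losses, each of relative size at most [d], come from the flight
   after the last jump, the finite memory and the high velocities. *)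
exists ((kap0 + 3) / 4), (d / (1 + r)), (d / (1 + r) + S), V; split => //.
- lra.
- by rewrite lerDl ltW.
move=> t x k k0 k1 St krho.
have VV : - V <= V by lra.
have := rho_ge_response k0 (ltW tau00) _ St VV krho.
rewrite lerDl => /(_ (ltW S0)); apply: le_trans.
rewrite tau0E [_ + S]addrC addrK.
have ed : 1 - d <= expR (- d) by exact: expR_ge1Dx.
have ed' : 1 - d <= 1 - expR (- S) by lra.
have d1' : 0 <= 1 - d by lra.
have h1 : (1 - d) * (1 - d) <= expR (- d) * (1 - expR (- S)) by exact: ler_pM.
have h2 : (1 - d) * (1 - d) * (1 - d) <=
    expR (- d) * (1 - expR (- S)) * mass (- V) V.
  by apply: ler_pM => //; exact: mulr_ge0.
have h3 : 1 - 3 * d <= (1 - d) * (1 - d) * (1 - d).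
  have d3 : 0 <= d * d * (3 - d).
    by apply: mulr_ge0; [apply: mulr_ge0; exact: ltW|lra].
  rewrite -subr_ge0 (_ : _ - _ = d * d * (3 - d))//; ring.
have gk := growth k k0 k1.
rewrite -[leRHS]mulrA; apply: (@le_trans _ _ (kap0 * k * (1 - 3 * d))).
  have E : kap0 * (1 - 3 * d) = (kap0 + 3) / 4 by lra.
  by rewrite [leRHS]mulrAC E.
have kk : 0 <= kap0 * k by apply: mulr_ge0; lra.
apply: ler_pM => //; [lra|exact: le_trans h2].
Qed.

(** However large [c] and however small the rate [lam], particles that are fast
    enough reach so far ahead that the gain [exp (lam B)] on the distance
    [B = (v1 - c) T1], measured in the frame moving with speed [c], outweighs
    both their rarity and the losses during the flight. *)
Lemma fast_particles c lam tau0 : 0 < lam -> 0 < tau0 ->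
  exists v1 T1 : R, [/\ c < v1, tau0 <= T1 &
    forall t x k, 0 <= k -> k <= 2^-1 -> T1 + 1 <= t ->
    (forall v tau : R, v1 <= v <= v1 + 1 -> T1 <= tau <= T1 + 1 ->
       k <= rho (t - tau) (x - v * tau)) ->
    expR (- (lam * ((v1 - c) * T1))) * k <= rho t x].
Proof.
move=> lam0 tau00; have r0 := r_gt0.
(* On a flight of duration [T1] the gain factor is [exp ((2 + r) T1)] and the
   loss factor [exp (- (1 + r) T1)]: their product [exp T1] beats the rarity [q]. *)
remember (c + (2 + r) / lam) as v1 eqn:v1D.
have v1c : lam * (v1 - c) = 2 + r.
  by rewrite v1D addrAC subrr add0r mulrC divfK// gt_eqF.
have v1c0 : 0 < v1 - c by rewrite -(pmulr_rgt0 _ lam0) v1c; lra.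
have mu0 : 0 < mass v1 (v1 + 1) by apply: mass_gt0; lra.
have e1 : 0 < 1 - expR (- 1) :> R by rewrite subr_gt0 -[ltRHS]expR0 ltr_expR; lra.
remember ((1 - expR (- 1)) * mass v1 (v1 + 1)) as q eqn:qD.
have q0 : 0 < q by rewrite qD mulr_gt0.
exists v1, (tau0 + q^-1); split; first lra.
  by rewrite lerDl invr_ge0 ltW.
have q10 : 0 < q^-1 by rewrite invr_gt0.
have eq : 1 <= q * expR (tau0 + q^-1).
  rewrite -ler_pdivrMl// mulr1; apply: le_trans (expR_ge1Dx _); lra.
move: (tau0 + q^-1) (addr_gt0 tau00 q10) eq => T1 T10 eq.
move=> t x k k0 k1 Tt krho.
have vv : v1 <= v1 + 1 by lra.
have k1' : k <= 1 by lra.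
have T11 : T1 <= T1 + 1 by lra.
have := rho_ge_response k0 (ltW T10) T11 Tt vv krho; apply: le_trans.
rewrite [T1 + 1]addrC addrK.
move: (response r k) (response_ge_id k0 k1') => phi phik.
rewrite (_ : phi * _ * _ = phi * (expR (- ((1 + r) * T1)) * q)); last first.
  by rewrite qD; ring.
rewrite mulrC.
apply: ler_pM => //.
have -> : - (lam * ((v1 - c) * T1)) = - ((1 + r) * T1) - T1.
  by rewrite mulrA v1c; ring.
rewrite expRD ler_pM2l ?expR_gt0// expRN -[leLHS]mulr1 ler_pdivrMl ?expR_gt0//.
by rewrite mulrC.
Qed.

(** The comparison with the front looks back over a bounded time; this bound,
    from the transported initial datum alone, starts the induction. *)
Lemma initial_layer S : 0 <= S ->
  exists2 m : R, 0 < m & forall t x, 0 <= t -> t <= S -> x <= xL - S -> m <= rho t x.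
Proof.
move=> S0; have mu0 : 0 < mass (- 1) 1 by apply: mass_gt0; lra.
exists (gamma * expR (- ((1 + r) * S)) * mass (- 1) 1).
  by rewrite !mulr_gt0 ?expR_gt0.
move=> t x t0 tS xS; apply: rho_ge_mass => //.
  by rewrite mulr_ge0 ?expR_ge0// ltW.
move=> v /andP[vl vu]; apply: le_trans (g_ge_initial _ _ t0).
have vt : - t <= v * t by rewrite -mulN1r; apply: ler_wpM2r.
have g0v : gamma * M v <= g0 (x - v * t) v by apply: g0_left; lra.
rewrite mulrAC; apply: ler_pM => //.
- by rewrite mulr_ge0 ?ltW.
- by rewrite ler_expR lerN2; apply: ler_wpM2l => //; have := r_gt0; lra.
Qed.

(** The comparison front in the moving frame.  Its flat part on the left keeps it
    below the small level where the growth of [slow_particles] is available. *)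
Definition profile (lam z : R) := expR (- (lam * Num.max 0 z)).

Lemma profile_gt0 lam z : 0 < profile lam z. Proof. exact: expR_gt0. Qed.

Lemma profile_le1 lam z : 0 <= lam -> profile lam z <= 1.
Proof.
by move=> lam0; rewrite -expR0 ler_expR oppr_le0 mulr_ge0 ?le_max ?lexx.
Qed.

Lemma profile_le lam z z' : 0 <= lam -> z <= z' -> profile lam z' <= profile lam z.
Proof.
move=> lam0 zz; rewrite ler_expR lerN2; apply: ler_wpM2l => //.
by rewrite ge_max !le_max lexx/= zz orbT.
Qed.

Lemma profile_shift lam z A : 0 <= lam -> 0 <= A ->
  expR (- (lam * A)) * profile lam z <= profile lam (z + A).
Proof.
move=> lam0 A0; rewrite -expRD ler_expR -opprD lerN2 -mulrDr; apply: ler_wpM2l => //.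
rewrite ge_max; apply/andP; split; first by rewrite addr_ge0 ?le_max ?lexx.
by rewrite addrC lerD2l le_max lexx orbT.
Qed.

Lemma profile_back lam z B : 0 <= B -> 0 <= z - B ->
  profile lam (z - B) = expR (lam * B) * profile lam z.
Proof.
move=> B0 zB; rewrite -expRD /profile !(max_idPr _)//; last lra.
by congr expR; ring.
Qed.

(** The front [m * profile lam (x - c t - z0)], cut off at distance [L], stays
    below the density.  Away from the cut-off the growth produced by slow
    particles compensates the decay of the profile over the distance [A] that
    they travel, if [lam] is small; within [A] of the cut-off slow particles may
    come from beyond it, and the fast ones take over.  All these particles jumped
    at least [tau0] ago, so the comparison is an induction on time steps. *)
Lemma front_invasion c : 0 < c ->
  exists m z0 : R, 0 < m /\ forall t x, 0 <= t -> x <= c * t + z0 -> m <= rho t x.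
Proof.
move=> c0; have [kap [tau0 [S [V [kap1 tau00 tauS V0 slow]]]]] := slow_particles.
have S0 : 0 < S by exact: lt_le_trans tauS.
have A0 : 0 < (V + c) * S by rewrite mulr_gt0//; lra.
remember ((V + c) * S) as A eqn:AD.
(* the largest rate for which [kap * (1 - lam * A) >= 1] *)
remember ((1 - kap^-1) / A) as lam eqn:lamD.
have lam0 : 0 < lam by rewrite lamD divr_gt0// subr_gt0 invf_lt1; lra.
have slowA : 1 <= kap * expR (- (lam * A)).
  have -> : lam * A = 1 - kap^-1 by rewrite lamD divfK// gt_eqF.
  have := expR_ge1Dx (- (1 - kap^-1)); rewrite opprB addrCA subrr addr0 => h.
  by rewrite -ler_pdivrMl ?mulr1//; lra.
have [v1 [T1 [cv1 tauT1 fast]]] := fast_particles c lam0 tau00.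
have T10 : 0 < T1 by exact: lt_le_trans tauT1.
have B0 : 0 < (v1 - c) * T1 by rewrite mulr_gt0//; lra.
remember ((v1 - c) * T1) as B eqn:BD.
have [|m1 m10 init] := @initial_layer (S + T1 + 1); first lra.
remember (S + T1 + 1) as S' eqn:S'D.
remember (Num.min 2^-1 m1) as m eqn:mD.
have m0 : 0 < m by rewrite mD lt_min m10 andbT; lra.
have m12 : m <= 2^-1 by rewrite mD ge_min lexx.
have mm1 : m <= m1 by rewrite mD ge_min lexx orbT.
remember (A + B) as L eqn:LD.
(* up to time [S'] the front lies in the region controlled by [initial_layer] *)
remember (xL - S' - c * S' - L) as z0 eqn:z0D.
have f0 := profile_gt0 lam; have f1 z := profile_le1 z (ltW lam0).
have mf0 z : 0 <= m * profile lam z by rewrite mulr_ge0// ltW.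
have mf1 z : m * profile lam z <= 2^-1.
  by apply: le_trans m12; rewrite ler_piMr// ltW.
have base t x : 0 <= t -> t <= S' -> x - c * t - z0 <= L ->
    m * profile lam (x - c * t - z0) <= rho t x.
  move=> t0 tS' zL; apply: (@le_trans _ _ m); first by rewrite ler_piMr// ltW.
  apply: le_trans mm1 _; apply: init => //.
  have : c * t <= c * S' by rewrite ler_pM2l.
  lra.
have SS' : S <= S' by lra.
have TS' : T1 + 1 <= S' by lra.
have L0 : 0 < L by rewrite LD addr_gt0.
clear init S'D z0D mD lamD m10 mm1.
have main n t x : 0 <= t -> t <= n%:R * tau0 -> x - c * t - z0 <= L ->
    m * profile lam (x - c * t - z0) <= rho t x.
  elim: n t x => [|n IH] t x t0 tn.
    by apply: base => //; rewrite mul0r in tn; lra.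
  have [tS'|S't] := leP t S'; first exact: base.
  remember (x - c * t - z0) as z eqn:zD; move=> zL.
  have past v tau z' : tau0 <= tau -> tau <= t -> z' <= L ->
      z - (v - c) * tau <= z' ->
      m * profile lam z' <= rho (t - tau) (x - v * tau).
    move=> tau0' taut z'L zz'.
    have E : x - v * tau - c * (t - tau) - z0 = z - (v - c) * tau.
      by rewrite zD; ring.
    apply: (@le_trans _ _ (m * profile lam (z - (v - c) * tau))).
      by rewrite ler_pM2l//; apply: profile_le => //; exact: ltW.
    rewrite -E; apply: IH; first by rewrite subr_ge0.
      rewrite -natr1 mulrDl mul1r in tn; lra.
    by rewrite E; exact: le_trans zz' z'L.
  clear tn IH zD base t0.
  have [zA|zA] := leP (z + A) L.
  - have := slow t x (m * profile lam (z + A)) (mf0 _) (mf1 _).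
    have St : S <= t by exact: le_trans (ltW S't).
    move=> /(_ St) slow'; apply: le_trans (slow' _); last first.
      move=> v tau /andP[vl vu] /andP[tl tu].
      apply: past => //; first exact: le_trans St.
      have : (c - v) * tau <= (V + c) * S.
        apply: (@le_trans _ _ ((V + c) * tau)).
          apply: ler_wpM2r; first exact: le_trans (ltW tau00) tl.
          by rewrite addrC lerD2r lerNl.
        by apply: ler_wpM2l => //; rewrite addr_ge0// ltW.
      by move=> cvA; apply: lerD => //; rewrite AD -mulNr opprB.
    have fA := profile_shift z (ltW lam0) (ltW A0).
    rewrite mulrCA ler_pM2l//.
    apply: (@le_trans _ _ (kap * (expR (- (lam * A)) * profile lam z))); last first.
      by apply: ler_wpM2l => //; exact: ltW (lt_trans ltr01 kap1).
    by rewrite mulrA ler_peMl// ltW.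
  - have zB : 0 <= z - B by lra.
    have zBL : z - B <= L by lra.
    have := fast t x (m * profile lam (z - B)) (mf0 _) (mf1 _).
    have Tt : T1 + 1 <= t by exact: le_trans (ltW S't).
    move=> /(_ Tt) fast'; apply: le_trans (fast' _); last first.
      move=> v tau /andP[vl vu] /andP[tl tu].
      apply: past; [exact: le_trans tl|exact: le_trans Tt|exact: zBL|].
      have : (v1 - c) * T1 <= (v - c) * tau.
        by apply: ler_pM => //; [rewrite subr_ge0 ltW|exact: ltW|rewrite lerD2r].
      by move=> vB; apply: lerD => //; rewrite lerN2 BD.
    have := profile_back lam (ltW B0) zB => ->.
    have e1 : expR (- (lam * B)) * expR (lam * B) = 1 by rewrite -expRD addNr expR0.
    move: (profile lam z) => p; move: e1.
    move: (expR (- (lam * B))) (expR (lam * B)) => a b ab1.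
    have -> : a * (m * (b * p)) = a * b * (m * p) by ring.
    by rewrite ab1 mul1r.
exists (m * profile lam L), z0; split; first by rewrite mulr_gt0.
move=> t x t0 xz.
have zle : x - c * t - z0 <= L by lra.
have tn : t <= (Num.truncn (t / tau0)).+1%:R * tau0.
  by rewrite -ler_pdivrMr// ltW//; exact: truncnS_gt.
apply: le_trans (main _ t x t0 tn zle).
by rewrite ler_pM2l//; apply: profile_le => //; exact: ltW.
Qed.

(** * Convergence behind the front *)

Definition spreads m c :=
  exists2 T : R, 0 <= T & forall t x, T <= t -> x <= c * t -> m <= rho t x.

Lemma spreadsW m m' c c' : m' <= m -> c' <= c -> spreads m c -> spreads m' c'.
Proof.
move=> mm cc [T T0 H]; exists T => // t x Tt xc; apply: le_trans mm _.
by apply: H => //; apply: le_trans xc _; apply: ler_wpM2r => //; exact: le_trans Tt.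
Qed.

(** Bounded velocities carry over a bounded time only a bounded distance, so a
    slower front eventually sees only the region where the density exceeds [m]. *)
Lemma spreads_profile m c c' V S : 0 <= m -> 0 <= c -> c' < c -> 0 <= V -> 0 <= S ->
  spreads m c -> exists2 T : R, 0 <= T & forall t x v, T <= t -> x <= c' * t ->
    - V <= v <= V -> response r m * (1 - expR (- S)) * M v <= g t x v.
Proof.
move=> m0 c0 cc V0 S0 [T T0 H].
have cc' : 0 < c - c' by lra.
have VS0 : 0 <= (V + c) * S by apply: mulr_ge0 => //; lra.
pose D := (V + c) * S / (c - c').
have D0 : 0 <= D by rewrite divr_ge0// ltW.
exists (T + S + D); first lra.
move=> t x v Tt xc /andP[v1 v2].
have Dt : (V + c) * S <= t * (c - c').
  rewrite -ler_pdivrMr// -/D; move: D D0 Tt => D D0 Tt; lra.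
have := @g_ge_response t x v m 0 S m0 (lexx 0) S0.
rewrite mulr0 oppr0 expR0 mul1r addr0; apply; first lra.
move=> tau /andP[tau0 tauS]; apply: H; first lra.
have : - v * tau <= V * S by apply: (@le_trans _ _ (V * tau)); nra.
have : c * tau <= c * S by nra.
nra.
Qed.

(** By [spreads_profile], integrating over the velocities: the missing relaxation
    time and the missing high velocities each cost an arbitrarily small fraction. *)
Lemma spreads_improve m m' c c' : 0 < m -> 0 <= c -> c' < c -> 0 <= m' ->
  m' < response r m -> spreads m c -> spreads m' c'.
Proof.
move=> m0 c0 cc m'0; move: (@spreads_profile m c c').
have := @response_ge0 _ r m (ltW r_gt0) (ltW m0).
move: (response r m) => phi phi0 prof m'phi spr.
have phi1 : 0 < phi by lra.
pose d := (phi - m') / (2 * phi).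
have d0 : 0 < d by rewrite divr_gt0//; lra.
have dE : phi * d * 2 = phi - m' by rewrite /d; field; lra.
have d1 : d <= 1 by rewrite ler_pdivrMr; lra.
have [S S0 eS] := expR_small d0.
have [V V0 mV] := mass_total d0.
have [T T0 H] := prof V S (ltW m0) c0 cc (ltW V0) (ltW S0) spr.
exists T => // t x Tt xc.
have e0 : expR (- S) <= 1 by lra.
have k0 : 0 <= phi * (1 - expR (- S)) by rewrite mulr_ge0//; lra.
apply: le_trans (rho_ge_mass (t := t) (x := x) _ k0 _ (u := - V) (w := V) _); last 3 first.
- lra.
- lra.
- by move=> v vV; exact: H.
have : phi * (1 - d) <= phi * (1 - expR (- S)) by apply: ler_wpM2l; lra.
move: (phi * (1 - expR (- S))) k0 => K K0 KK.
apply: (@le_trans _ _ (K * (1 - d))); last exact: ler_wpM2l.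
apply: (@le_trans _ _ (phi * (1 - d) * (1 - d))); last by apply: ler_wpM2r; lra.
nra.
Qed.

(** The response map [k |-> (1 + r) k / (1 + r k)] contracts the distance to the
    fixed point [1] by the factor [1 / (1 + r k)]; iterating it while giving away
    a little speed each time brings the density to any level below [1]. *)
Lemma spreads_near1 c e : 0 < c -> 0 < e ->
  (forall c, 0 < c -> exists2 m : R, 0 < m & spreads m c) -> spreads (1 - e) c.
Proof.
move=> c0 e0 /(_ (c + 1))[|m1 m10 spr1]; first lra.
pose m0 := Num.min m1 2^-1.
have m00 : 0 < m0 by rewrite lt_min m10; lra.
have m01 : m0 <= 2^-1 by rewrite ge_min lexx orbT.
have spr0 : spreads m0 (c + 1) by apply: spreadsW spr1 => //; rewrite ge_min lexx.
move: m0 m00 m01 spr0 => m0 m00 m01 spr0 {m1 m10 spr1}.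
(* Half of the available contraction rate; the other half makes the inequality
   required by [spreads_improve] strict. *)
pose h := r * m0 / 2.
have h0 : 0 < h by rewrite divr_gt0// mulr_gt0.
pose om := (1 + h)^-1.
have om0 : 0 < om by rewrite invr_gt0; lra.
have om1 : om < 1 by rewrite invf_lt1; lra.
have omE : om * (1 + h) = 1 by rewrite mulVf// gt_eqF//; lra.
have omn0 n : 0 < om ^+ n by exact: exprn_gt0.
have omn1 n : om ^+ n <= 1 by apply: exprn_ile1; lra.
have step n : spreads (1 - (1 - m0) * om ^+ n) (c + n.+1%:R^-1).
  elim: n => [|n IH].
    by apply: spreadsW spr0; rewrite ?expr0 ?invr1 ?mulr1 // opprB addrC subrK.
  pose p := om ^+ n; have p0 : 0 < p := omn0 n; have p1 : p <= 1 := omn1 n.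
  have cn : c + n.+2%:R^-1 < c + n.+1%:R^-1.
    by rewrite ltrD2l ltf_pV2 ?posrE// ltr_nat.
  have mn0 : m0 <= 1 - (1 - m0) * p by nra.
  have mn1 : (1 - m0) * p <= 1 by nra.
  have q0 : 0 < (1 - m0) * p by rewrite mulr_gt0//; lra.
  rewrite exprSr -/p mulrA; rewrite -/p in IH.
  move: ((1 - m0) * p) q0 mn0 mn1 IH => q q0 q1 q2 IH.
  have qom : q * om <= q * 1 by rewrite ler_pM2l// ltW.
  apply: (spreads_improve _ _ cn _ _ IH).
  - lra.
  - by apply: addr_ge0 => //; lra.
  - lra.
  - have rm0 : 0 < r * m0 by exact: mulr_gt0.
    have rm0q : r * m0 <= r * (1 - q) by rewrite ler_pM2l.
    have rq : 0 < 1 + r * (1 - q) by lra.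
    rewrite /response ltr_pdivlMr//.
    have hq : h < r * (1 - q) by rewrite /h; lra.
    have : q * om * (1 + h) = q by rewrite -mulrA omE mulr1.
    have : 0 < q * om by exact: mulr_gt0.
    move: (q * om) => z z0 zE.
    have : z * h < z * (r * (1 - q)) by rewrite ltr_pM2l.
    nra.
have bern n : 1 + n%:R * h <= (1 + h) ^+ n.
  elim: n => [|n IH]; first by rewrite mul0r addr0 expr0.
  rewrite exprS -natr1.
  have : 0 <= n%:R * h by rewrite mulr_ge0// ltW.
  nra.
pose n := Num.truncn (e * h)^-1.
have hn : (e * h)^-1 < n.+1%:R by exact: truncnS_gt.
apply: spreadsW (step n.+1); last by rewrite lerDl.
rewrite lerD2l lerN2.
apply: (@le_trans _ _ (om ^+ n.+1)).
  by rewrite ler_piMl ?(ltW (omn0 _))//; lra.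
rewrite /om exprVn -[leRHS]invrK lef_pV2 ?posrE ?invr_gt0 ?exprn_gt0//; last lra.
apply: le_trans (bern _).
have : e^-1 <= n.+1%:R * h.
  by rewrite -ler_pdivrMr// -invfM ltW.
lra.
Qed.

(** The shift [z0] is absorbed by a front that is faster by one. *)
Lemma spreads_every_speed c : 0 < c -> exists2 m : R, 0 < m & spreads m c.
Proof.
move=> c0; have [|m [z0 [m0 H]]] := @front_invasion (c + 1); first lra.
exists m => //; exists `|z0| => // t x zt xc.
have t0 : 0 <= t by exact: le_trans zt.
apply: H => //; have := ler_norm (- z0); rewrite normrN; lra.
Qed.

Lemma convergence_to_equilibrium c v e : 0 < c -> 0 < e ->
  exists T : R, forall t x, T <= t -> x <= c * t -> M v - e <= g t x v.
Proof.
move=> c0 e0; have Mv := M_gt0 v.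
pose d := Num.min (e / (2 * M v)) 2^-1.
have d0 : 0 < d by rewrite lt_min divr_gt0 ?mulr_gt0//; lra.
have dM : d * M v * 2 <= e.
  by rewrite -mulrA [M v * 2]mulrC -ler_pdivlMr ?mulr_gt0// ge_min lexx.
have d1 : d <= 2^-1 by rewrite ge_min lexx orbT.
have [S S0 eS] := expR_small d0.
have spr : spreads (1 - d) (c + 1).
  by apply: spreads_near1 => //; [lra|exact: spreads_every_speed].
have m0 : 0 <= 1 - d by lra.
have c1 : 0 <= c + 1 by lra.
have cc : c < c + 1 by rewrite ltrDl.
have [T _ H] := spreads_profile m0 c1 cc (normr_ge0 v) (ltW S0) spr.
exists T => t x Tt xc.
have vv : - `|v| <= v <= `|v| by rewrite -ler_norml.
apply: le_trans (H t x v Tt xc vv).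
have phi : 1 - d <= response r (1 - d).
  by apply: response_ge_id; lra.
have : (1 - d) * (1 - d) <= response r (1 - d) * (1 - expR (- S)).
  by apply: ler_pM; lra.
move: (_ * (1 - expR (- S))) => K KK.
apply: (@le_trans _ _ ((1 - d) * (1 - d) * M v)); last first.
  by apply: ler_wpM2r => //; exact: ltW.
nra.
Qed.

End propagation.

(** * Convergence in the supremum norm *)

Theorem proposition1p9 (R : realType) (r : R) (M : R -> R)
    (g0 : R -> R -> R) (g : R -> R -> R -> R)
    (r_gt0 : 0 < r)
    (M_profile : velocity_profile M)
    (M_gt0 : forall v : R, 0 < M v)
    (g0_Linfty : (fun z : R * R => g0 z.1 z.2) \in
       Lfun (lebesgue_measure \x lebesgue_measure)%E +oo%E)
    (g0_bounds : forall x v : R, 0 <= g0 x v <= M v)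
    (g0_left : exists xL gamma : R, 0 < gamma < 1 /\
       forall x v : R, x <= xL -> gamma * M v <= g0 x v)
    (g_sol : kinetic_solution r M g0 g) :
  forall c : R, 0 < c ->
  forall v : R,
    ereal_sup [set (`|M v - g t x v|)%:E | x in [set x : R | x <= c * t]]
      @[t --> +oo%R] --> 0%E.
Proof.
move=> c c0 v; have [xL [gamma [/andP[gamma0 _] left]]] := g0_left.
have conv e : 0 < e ->
    exists T : R, forall t x, T <= t -> x <= c * t -> M v - e <= g t x v.
  apply: (@convergence_to_equilibrium R r M (velocity_mass M) (macro_density g)
    g0 g xL gamma) => //.
  - exact: velocity_mass_gt0.
  - exact: velocity_mass_total.
  - exact: (macro_density_ge_mass M_profile g_sol).
  - exact: (g_ge_response r_gt0 M_profile g0_bounds g_sol).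
  - exact: (g_ge_initial r_gt0 M_profile g0_bounds g_sol).
pose F t := ereal_sup [set (`|M v - g t x v|)%:E | x in [set x : R | x <= c * t]].
have F_small e : 0 < e -> \forall t \near +oo, (0 <= F t <= e%:E)%E.
  move=> e0; have [T HT] := conv e e0.
  near=> t.
  have Tt : T <= t by near: t; apply: nbhs_pinfty_ge; exact: num_real.
  have t0 : 0 <= t by near: t; apply: nbhs_pinfty_ge; exact: num_real.
  apply/andP; split.
    apply: (@le_trans _ _ (`|M v - g t (c * t) v|)%:E); first by rewrite lee_fin.
    by apply: ereal_sup_ubound; exists (c * t) => //=.
  apply: ge_ereal_sup => _ [x /= xc <-]; rewrite lee_fin.
  by rewrite ger0_norm ?subr_ge0 ?(g_leM g_sol)// lerBlDr addrC -lerBlDr; exact: HT.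
apply/fine_cvgP; split.
  apply: filterS (F_small 1 ltr01) => t /andP[F0 F1].
  by rewrite fin_numElt (lt_le_trans _ F0)// (le_lt_trans F1)// ltry.
apply/cvgrPdist_le => e e0; apply: filterS (F_small e e0) => t /andP[F0 F1].
rewrite sub0r normrN ger0_norm ?fine_ge0// -lee_fin fineK//.
by rewrite fin_numElt (lt_le_trans _ F0)// (le_lt_trans F1)// ltry.
Unshelve. all: by end_near.
Qed.
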